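(* Let $n,\Delta,\sigma$ be nonnegative integers. There exists an edge-colored, unweighted, undirected graph $G=(V,E)$ with $\Theta(n)$ vertices, in which every color class has at most $\Delta$ edges, and a source set $S\subseteq V$ with $|S|=\sigma$, such that every $1$-CFT $S\times V$ distance preserver of $G$ has \[ \Omega\Big( n^{2-\frac{1}{\Delta+1}} \cdot \sigma^{\frac{1}{\Delta+1}} \cdot \tfrac{1}{\Delta}\Big)\text{ edges.} \]
   Context: An edge-colored graph assigns each edge exactly one color, with no restrictions; a color class is the set of edges of one color. For a color $c$, $G-c$ denotes $G$ with all edges of color $c$ deleted. A subgraph $H\subseteq G$ is a $1$-CFT $S\times V$ distance preserver if for every color $c$, every $s\in S$ and every $t\in V$, the distance from $s$ to $t$ in $H-c$ equals that in $G-c$.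
   Formalization: Assumes σ ≤ K·n for an arbitrary fixed K, with constants depending only on K (a set of σ sources cannot fit in Θ(n) vertices otherwise); for Δ = 0, where 1/Δ is undefined, the bound is read as 0. *)

(* Defs.v *)
From mathcomp Require Import all_boot all_order all_algebra.
From mathcomp Require Import reals exp.

Set Implicit Arguments.
Unset Strict Implicit.
Unset Printing Implicit Defensive.

(* Edges are unordered pairs of vertices.  The values of [col] on sets that are
   not edges are never used. *)
Record ecgraph := ECGraph {
  vertex : finType;
  edges : {set {set vertex}};
  edges_card2 : forall e, e \in edges -> #|e| = 2;
  color : finType;
  col : {set vertex} -> color }.

Definition adj (V : finType) (F : {set {set V}}) : rel V :=
  fun x y => [set x; y] \in F.

Definition walk (V : finType) (F : {set {set V}}) (k : nat) (x y : V) : bool :=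
  [exists p : k.-tuple V, path (adj F) x p && (last x p == y)].

(* The least length of a walk from x to y, or None (infinite distance) if there
   is no walk.  Restricting to lengths below #|V| loses nothing, see distP and
   dist_infP. *)
Definition dist (V : finType) (F : {set {set V}}) (x y : V) : option nat :=
  ohead [seq k <- iota 0 #|V| | walk F k x y].

Definition color_class (G : ecgraph) (k : color G) : {set {set vertex G}} :=
  [set e in edges G | col e == k].

(* The colors that occur on some edge. *)
Definition colors (G : ecgraph) : {set color G} :=
  [set col e | e in edges G].

(* Subgraphs are spanning and given by their edge sets: H - k. *)
Definition del_color (G : ecgraph) (H : {set {set vertex G}}) (k : color G) :=
  H :\: color_class k.

Definition cft1_preserver (G : ecgraph) (S : {set vertex G})
    (H : {set {set vertex G}}) : Prop :=
  H \subset edges G /\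
  forall k, k \in colors G -> forall s t, s \in S ->
    dist (del_color H k) s t = dist (del_color (edges G) k) s t.

Lemma walkP (V : finType) (F : {set {set V}}) k x y :
  reflect (exists p, [/\ size p = k, path (adj F) x p & last x p = y])
          (walk F k x y).
Proof.
apply: (iffP existsP) => [[p /andP[pp /eqP lp]]|[p [sp pp lp]]].
  by exists p; rewrite size_tuple.
have sp' : size p == k by apply/eqP.
by exists (Tuple sp'); rewrite /= pp lp eqxx.
Qed.

Lemma walk_short (V : finType) (F : {set {set V}}) k x y :
  walk F k x y -> exists2 j, j <= k & (j < #|V|) && walk F j x y.
Proof.
case/walkP=> p [<- pp lp].
case: (shortenP pp) lp => q qp uq qsub lq.
exists (size q).
  by apply: uniq_leq_size => //; case/andP: uq.
apply/andP; split; last by apply/walkP; exists q.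
by rewrite -[(size q).+1]/(size (x :: q)) -(card_uniqP uq) max_card.
Qed.

Lemma distP (V : finType) (F : {set {set V}}) k x y :
  dist F x y = Some k <->
  walk F k x y /\ forall j, walk F j x y -> k <= j.
Proof.
have aux n m : ohead [seq j <- iota m n | walk F j x y] = Some k <->
    [/\ m <= k < m + n, walk F k x y &
        forall j, m <= j -> walk F j x y -> k <= j].
  elim: n m => [|n IHn] m /=.
    by split=> // -[/andP[mk]]; rewrite addn0 ltnNge mk.
  case: ifP => [wm|nwm] /=.
    split=> [[<-]|[/andP[mk _] wk min]].
      by split=> //; rewrite leqnn addnS ltnS leq_addr.
    by congr Some; apply/eqP; rewrite eqn_leq mk min.
  rewrite IHn addSnnS; split=> -[/andP[mk kn] wk min]; split=> //.
  - by rewrite (ltnW mk).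
  - move=> j; rewrite leq_eqVlt => /predU1P[<-|]; first by rewrite nwm.
    exact: min.
  - rewrite kn andbT ltn_neqAle mk andbT.
    by apply: contraFneq nwm => ->.
  - by move=> j /ltnW; apply: min.
rewrite /dist aux add0n; split=> [[_ wk min]|[wk min]].
  by split=> // j; apply: min.
split=> //; last by move=> j _; apply: min.
have [j jk /andP[jV wj]] := walk_short wk.
by rewrite (leq_ltn_trans (min j wj)).
Qed.

Lemma dist_infP (V : finType) (F : {set {set V}}) x y :
  dist F x y = None <-> ~~ connect (adj F) x y.
Proof.
split=> [dN|nc].
  apply/negP => /connectP[p pp lp].
  have : walk F (size p) x y by apply/walkP; exists p.
  case/walk_short=> j _ /andP[jV wj].
  have : j \in [seq k <- iota 0 #|V| | walk F k x y].
    by rewrite mem_filter wj mem_iota.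
  by move: dN; rewrite /dist; case: [seq _ <- _ | _].
case E: (dist F x y) => [k|//]; case/negP: nc.
have [/walkP[p [_ pp lp]] _] := (distP F k x y).1 E.
by apply/connectP; exists p.
Qed.

(* Main.v *)
Require Import Defs.
From mathcomp Require Import all_boot all_order all_algebra.
From mathcomp Require Import reals exp.
From mathcomp Require Import zify ring lra.
Set Implicit Arguments.
Unset Strict Implicit.
Unset Printing Implicit Defensive.
Import Order.TTheory GRing.Theory Num.Theory.

(* Hang the same rooted tree below each of sigma' sources, and join all its L
   leaves to n common targets.  Leaf t has depth decreasing with t, and one color
   kills exactly the leaves t' > t: each of the f levels of the tree consists of
   paths, broken every q l vertices, with a strand t leaving every q l.+1 vertices
   for the next level, and color t is put on the edge between positions t and t+1
   of each level.  When color t fails, leaf t is the unique closest surviving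
   leaf, so every edge from leaf t to a target is forced; this gives sigma' L n
   edges.  With q l about rho^(f-l), a tree has L ~ rho^f leaves and O(f rho^(f+1))
   vertices.  For f = Delta and rho^(Delta+1) ~ n / (Delta sigma) this is the claimed
   bound; if n / (Delta sigma) is below a constant, one leaf per source suffices. *)

(** * Unordered pairs and walks *)

Lemma set2_eq (T : finType) (a b c d : T) :
  [set a; b] = [set c; d] -> a = c /\ b = d \/ a = d /\ b = c.
Proof.
move=> e; have /set2P[ac|ad] : a \in [set c; d] by rewrite -e set21.
- subst c; left; split=> //.
  have /set2P[ba|//] : b \in [set a; d] by rewrite -e set22.
  have /set2P[da|da] : d \in [set a; b] by rewrite e set22.
    by rewrite ba.
  by [].
- subst d; right; split=> //.
  have /set2P[//|ba] : b \in [set c; a] by rewrite -e set22.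
  have /set2P[ca|ca] : c \in [set a; b] by rewrite e set21.
    by rewrite ba.
  by [].
Qed.

Section Walks.
Variables (V : finType) (F : {set {set V}}).

Lemma walk0 x : walk F 0 x x.
Proof. by apply/walkP; exists [::]. Qed.

Lemma walkS k x y : walk F k.+1 x y <-> exists2 z, walk F k x z & adj F z y.
Proof.
split=> [/walkP[p [sp pp lp]]|[z /walkP[p [sp pp lp]] zy]].
  case: (lastP p) sp pp lp => // p' y'; rewrite size_rcons rcons_path last_rcons.
  move=> [sp] /andP[pp ly] yE; exists (last x p'); last by rewrite -yE.
  by apply/walkP; exists p'.
apply/walkP; exists (rcons p y).
by rewrite size_rcons sp rcons_path pp lp last_rcons.
Qed.

Lemma walk_dist k x y :
  walk F k x y -> exists2 m, m <= k & dist F x y = Some m.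
Proof.
move=> wk; have ex_k : exists k', walk F k' x y by exists k.
case: (ex_minnP ex_k) => m wm min_m; exists m; first exact: min_m.
exact/distP.
Qed.

(** One-step bounds add up along a walk; a suitable [phi] thus bounds distances from below. *)
Lemma walk_lipschitz (phi : V -> nat) :
  (forall x y, adj F x y -> phi y <= (phi x).+1) ->
  forall k x y, walk F k x y -> phi y <= phi x + k.
Proof.
move=> lip; elim=> [|k IHk] x y.
  by case/walkP=> p [/size0nil -> _ /= ->]; rewrite addn0.
by case/walkS=> z /IHk le_z /lip; lia.
Qed.

End Walks.

(** * The colored graph: sources, trees and common targets *)

Section Construction.
Variables (n sigma sigma' f L N : nat) (q : nat -> nat).
Hypotheses (f_gt0 : 0 < f) (q0 : q 0 = L.+1) (qf : q f = 1).
Hypothesis q_gt0 : forall l, 0 < q l.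
(** Room for all codes of level [l]: one block of [2 * q l] codes for each multiple of [q l.+1] up
    to [L]. *)
Hypothesis tailN : forall l, l < f -> (L %/ q l.+1).+1 * (2 * q l) <= N.
Hypothesis le_sigma : sigma' <= sigma.

Definition offset l := \sum_(j < l) 2 * q j.

Definition tree : finType := ('I_f.+1 * 'I_L.+1 + 'I_f * 'I_N)%type.

(* inl (l, t) is position t on level l.  inr (l, u) lies on the connection from
   level l to level l.+1: u encodes the number of the connection, u %/ (2 * q l),
   and the distance to its lower end, u %% (2 * q l).  Codes that overshoot the
   actual connection are vertices that do no harm. *)
Definition strand (w : tree) : nat :=
  match w with
  | inl (_, t) => t
  | inr (l, u) => u %/ (2 * q l) * q l.+1
  end.

(* Connections are long enough to make position t on level f have depth
   offset f + 1 - t. *)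
Definition depth (w : tree) : nat :=
  match w with
  | inl (l, t) => (offset l + 2 * (t %% q l) - t).+1
  | inr (l, u) => offset l.+1 - strand w - u %% (2 * q l)
  end.

Definition jump (w w' : tree) : bool :=
  match w, w' with
  | inl (l, t), inl (l', t') => (l == l') && (t' == t.+1 :> nat)
  | _, _ => false
  end.

(** The depth condition itself breaks a level at the multiples of [q l], where depth drops. Arcs
    within a strand may ignore levels, as the lower bound on distances sees only depth and
    strand. *)
Definition tree_arc (w w' : tree) : bool :=
  (depth w' == (depth w).+1) && ((strand w' == strand w) || jump w w').

Definition vert : finType := ('I_sigma + 'I_n + 'I_sigma' * tree)%type.

Definition is_leaf (w : tree) : bool :=
  if w is inl (l, t) then (l == f :> nat) && (t < L) else false.

Definition arc (u v : vert) : bool :=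
  match u, v with
  | inl (inl s), inr (s', w) => (s == s' :> nat) && (w == inl (ord0, ord0))
  | inr (s, w), inr (s', w') => (s == s') && tree_arc w w'
  | inr (_, w), inl (inr _) => is_leaf w
  | _, _ => false
  end.

Definition main (s : 'I_sigma') (l t : nat) : vert := inr (s, inl (inord l, inord t)).

Definition jump_edge (s : 'I_sigma') (l t : nat) : {set vert} :=
  [set main s l t; main s l t.+1].

Definition tree_edges : {set {set vert}} :=
  [set e | [exists u, exists v, arc u v && (e == [set u; v])]].

(** [inl (s, t)] is shared by the edges between positions [t] and [t.+1] on all levels of tree [s];
    any other edge has a color of its own. *)
Definition tree_color : finType := ('I_sigma' * 'I_L + {set vert})%type.

Definition tree_col (e : {set vert}) : tree_color :=
  if [pick st : 'I_sigma' * 'I_L | [exists l : 'I_f.+1, e == jump_edge st.1 l st.2]]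
  is Some st then inl st else inr e.

Lemma tree_edgesP e :
  reflect (exists u v, arc u v /\ e = [set u; v]) (e \in tree_edges).
Proof.
rewrite inE; apply: (iffP existsP) => [[u /existsP[v /andP[uv /eqP->]]]|].
  by exists u, v.
by case=> u [v [uv ->]]; exists u; apply/existsP; exists v; rewrite uv eqxx.
Qed.

Lemma arc_neq u v : arc u v -> u != v.
Proof.
move: u v => [[s|x]|[s w]] [[s'|x']|[s' w']] //=.
case/andP=> _ /andP[dw _].
by apply: contraTneq dw => -[_ ->]; lia.
Qed.

Lemma tree_edges_card2 e : e \in tree_edges -> #|e| = 2.
Proof. by case/tree_edgesP=> u [v [/arc_neq uv ->]]; rewrite cards2 uv. Qed.

Definition tree_graph := ECGraph tree_edges_card2 tree_col.

(** * Sizes of the color classes *)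

Lemma main_inj s l t s' l' t' : l <= f -> l' <= f -> t <= L -> t' <= L ->
  main s l t = main s' l' t' -> [/\ s = s', l = l' & t = t'].
Proof.
move=> lf l'f tL t'L [-> el et].
by move: (congr1 val el) (congr1 val et); rewrite /= !inordK.
Qed.

Lemma tree_col_jump s l (t : 'I_L) : l <= f -> tree_col (jump_edge s l t) = inl (s, t).
Proof.
move=> lf; rewrite /tree_col; case: pickP => [[s' t'] /existsP[l' /eqP e]|/(_ (s, t))].
  have tL := ltn_ord t; have t'L := ltn_ord t'; have l'f := ltn_ord l'.
  case: (set2_eq e) => /= -[/main_inj e1 /main_inj e2].
    case: e1 => //; try lia; move=> -> _ tt.
    by congr (inl (_, _)); apply/val_inj.
  case: e1 => //; try lia; move=> _ _ tt.
  by case: e2 => //; lia.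
by case/existsP; exists (Ordinal (lf : l < f.+1)); rewrite eqxx.
Qed.

Lemma tree_col_inlP e s t :
  tree_col e = inl (s, t) -> exists2 l, l <= f & e = jump_edge s l t.
Proof.
rewrite /tree_col; case: pickP => // -[s' t'] /existsP[l /eqP ->] [<- <-].
by exists l; rewrite // -ltnS ltn_ord.
Qed.

Lemma mod_succ q' t : (t.+1 %% q' == (t %% q').+1) || (t.+1 %% q' == 0).
Proof. by rewrite modnS; case: ifP => _; rewrite ?eqxx ?orbT. Qed.

Lemma offsetS l : offset l.+1 = offset l + 2 * q l.
Proof. by rewrite /offset big_ord_recr. Qed.

Lemma offset_ge l : 0 < l -> 2 * L.+1 <= offset l.
Proof. by case: l => // l _; rewrite /offset big_ord_recl /= q0; lia. Qed.

(** Keeps the subtraction in [depth] from truncating. *)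
Lemma le_offset l t : t <= L -> t <= offset l + 2 * (t %% q l).
Proof.
case: l => [|l] tL; first by rewrite q0 modn_small ?ltnS //; lia.
by have := @offset_ge l.+1 isT; lia.
Qed.

Lemma depth_main l t : l <= f -> t <= L ->
  depth (inl (inord l, inord t)) = (offset l + 2 * (t %% q l) - t).+1.
Proof. by move=> lf tL; rewrite /= !inordK. Qed.


(** A shared color has at most one edge per level, and none on level [f]: since [q f = 1], depth
    falls there from each position to the next. *)
Lemma tree_color_class_le (k : color tree_graph) : #|color_class k| <= f.
Proof.
case: k => [[s t]|e]; last first.
  apply: leq_trans f_gt0; rewrite -(cards1 e); apply/subset_leq_card/subsetP => e'.
  rewrite inE => /andP[_ /eqP /=]; rewrite /tree_col.
  by case: pickP => // _ [->]; rewrite set11.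
rewrite -[leqRHS]card_ord -cardsT.
apply: leq_trans (leq_imset_card (fun l : 'I_f => jump_edge s l t) _).
apply/subset_leq_card/subsetP => e; rewrite inE => /andP[eE /eqP /tree_col_inlP].
case=> l; rewrite leq_eqVlt => /orP[/eqP lf|lf] eJ; last first.
  by apply/imsetP; exists (Ordinal lf).
subst l e; case/tree_edgesP: eE => u [v [uv /set2_eq]].
have tL := ltn_ord t; have := le_offset f (ltnW tL); have := le_offset f tL.
rewrite qf !modn1 => h1 h2.
move=> uvE; suff: ~~ arc u v by rewrite uv.
case: uvE {uv} => -[<- <-]; rewrite /main /arc /tree_arc !depth_main //= ?inordK //;
by rewrite ?qf ?modn1 ?inordK //; lia.
Qed.

(** * Distances after the failure of one color *)

Section Fault.
Variables (s : 'I_sigma') (t : 'I_L).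

(** The depth of leaf [t]. *)
Let D := (offset f - t).+1.
Let F := @del_color tree_graph tree_edges (inl (s, t)).

(* In the tree of source s, failure of color (s, t) disconnects exactly the strands
   beyond t; other trees never matter, their leaves being farther than leaf t. *)
Definition alive (v : vert) : bool :=
  match v with
  | inr (_, w) => strand w <= t
  | _ => true
  end.

(* A lower bound for the distance from source s once color (s, t) has failed. *)
Definition potential (v : vert) : nat :=
  match v with
  | inl (inl s') => if s' == s :> nat then 0 else D.+2
  | inl (inr _) => D.+1
  | inr (s', w) => if (s' == s) && (strand w <= t) then minn (depth w) D.+2 else D.+2
  end.

(** Only the deleted edges of tree [s] lead from strand [t] to strand [t.+1]. Leaves up to [t] have
    depth at least [D], and the cap [D.+2] keeps the deeper ones within one of the targets. *)
Lemma arc_potential u v : arc u v -> [set u; v] \in F ->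
  potential v <= (potential u).+1 /\ potential u <= (potential v).+1.
Proof.
move=> uv; rewrite in_setD => /andP[nc eE]; move: uv nc.
have tL := ltn_ord t.
have := offset_ge f_gt0.
rewrite inE eE /=.
move: u v {eE} => [[s1|x]|[s1 w]] [[s2|x']|[s2 w']] //= off.
- case/andP=> /eqP s12 /eqP -> _ /=; rewrite mod0n /offset big_ord0 s12 /=.
  by rewrite -[s2 == s]val_eqE /=; case: eqP => _ /=; lia.
- case: w => [[l t1]|//] /andP[/eqP lf t1L] _ /=.
  rewrite lf qf modn1; case: eqP => _ /=; last by lia.
  by case: ifP; rewrite /D; lia.
case/andP=> /eqP <- /andP[/eqP dw /orP[/eqP sw|jw]]; rewrite dw.
  by rewrite sw => _; case: ifP => _; lia.
move=> nc; case: (altP (s1 =P s)) => [s1s|_] /=; last by lia.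
case: w w' jw dw nc => [[l t1]|//] [[l' t2]|//] /= /andP[/eqP ll /eqP t12] dw.
subst l' s1; have [t1t|t1t _] := altP (nat_of_ord t1 =P t); last first.
  by rewrite t12; case: (ltnP t1 t); case: (leqP t1 t); lia.
have -> : inr (s, inl (l, t1)) = main s l t :> vert.
  by congr (inr (_, inl (_, _))); apply/val_inj; rewrite /= inordK //; lia.
have -> : inr (s, inl (l, t2)) = main s l t.+1 :> vert.
  by congr (inr (_, inl (_, _))); apply/val_inj; rewrite /= inordK //; lia.
by rewrite (tree_col_jump s t) ?eqxx // -ltnS ltn_ord.
Qed.

(** Every edge of the failed color has a dead end, at position [t.+1]. *)
Lemma arc_adj u v : arc u v -> alive u -> alive v -> adj F u v.
Proof.
move=> uv au av; rewrite /adj in_setD; apply/andP; split; last first.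
  by apply/tree_edgesP; exists u, v.
rewrite inE negb_and; apply/orP; right; apply/eqP=> /tree_col_inlP[l lf].
have := ltn_ord t => tL.
have dead : ~~ alive (main s l t.+1) by rewrite /= inordK; lia.
by case/set2_eq=> -[uE vE]; move: dead; rewrite -?uE -?vE ?au ?av.
Qed.

Definition source (i : 'I_sigma) : vert := inl (inl i).
Definition target (x : 'I_n) : vert := inl (inr x).

Let src := source (widen_ord le_sigma s).

(** Descends the connection of strand [t1], one depth at a time; the whole strand is alive. *)
Lemma walk_tail l t1 : l < f -> t1 <= t -> q l.+1 %| t1 ->
  walk F (offset l + 2 * (t1 %% q l) - t1).+1 src (main s l t1) ->
  walk F (offset l.+1 - t1).+1 src (main s l.+1 t1).
Proof.
move=> lf t1t dq w0; have tL := ltn_ord t.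
have t1L : t1 <= L by lia.
have t1off := le_offset l t1L; have offS := offsetS l.
have ml : t1 %% q l < q l by rewrite ltn_mod.
set h0 := (offset l + _ - _).+1 in w0.
have reach k : h0 + k <= offset l.+1 - t1 -> exists w,
    [/\ strand w = t1, depth w = h0 + k & walk F (h0 + k) src (inr (s, w))].
  elim: k => [_|k IHk hk].
    exists (inl (inord l, inord t1)).
    by rewrite addn0 depth_main ?(ltnW lf) // /strand inordK.
  have [|w [sw dw ww]] := IHk; first by lia.
  (* The number of connection vertices still below the next one. *)
  pose j := offset l.+1 - t1 - (h0 + k.+1).
  have j_lt : j < 2 * q l by rewrite /j /h0; lia.
  have uN : t1 %/ q l.+1 * (2 * q l) + j < N.
    apply: leq_trans (tailN lf).
    have : t1 %/ q l.+1 <= L %/ q l.+1 by apply: leq_div2r.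
    move: (t1 %/ _) (L %/ _) => a b ab.
    apply: (@leq_trans (a.+1 * (2 * q l))); first by rewrite mulSn; lia.
    by rewrite leq_mul2r ltnS ab orbT.
  pose w' : tree := inr (Ordinal lf, Ordinal uN).
  have q2_gt0 : 0 < 2 * q l by rewrite muln_gt0 q_gt0.
  have sw' : strand w' = t1.
    by rewrite /= divnMDl // (divn_small j_lt) addn0 divnK.
  have dw' : depth w' = h0 + k.+1.
    by rewrite /w' /depth -/w' sw' /= modnMDl (modn_small j_lt) /j; lia.
  exists w'; split; [exact: sw' | exact: dw' |].
  rewrite addnS; apply/walkS; exists (inr (s, w)); first exact: ww.
  apply: arc_adj; [|by rewrite /alive sw|by rewrite /alive sw'].
  by rewrite /arc eqxx /tree_arc dw dw' sw sw' eqxx andbT; apply/eqP; lia.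
have h0_le : h0 <= offset l.+1 - t1 by rewrite /h0; lia.
have [|w [sw dw ww]] := reach (offset l.+1 - t1 - h0); first by lia.
apply/walkS; exists (inr (s, w)).
  by move: ww; rewrite subnKC.
apply: arc_adj; rewrite /main ?[alive _]/= ?sw ?inordK //.
rewrite /arc eqxx /tree_arc depth_main // sw dw /= inordK // eqxx andbT.
by move: dq; rewrite /dvdn => /eqP ->; apply/eqP; lia.
Qed.

(** Multiples of [q l] are reached through a connection from the level above, other positions from
    their predecessor. Only positions up to [t] occur. *)
Lemma walk_main l t1 : l <= f -> t1 <= t ->
  walk F (offset l + 2 * (t1 %% q l) - t1).+1 src (main s l t1).
Proof.
have tL := ltn_ord t.
elim: l t1 => [|l IHl] t1 lf.
  rewrite q0 /offset big_ord0; elim: t1 => [_|t1 IHt1 t1t].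
    apply/walkS; exists src; first by rewrite mod0n; apply: walk0.
    apply: arc_adj; rewrite /main /= ?inordK //.
    rewrite eqxx; apply/eqP; congr (inl (_, _)); apply/val_inj; exact: inordK.
  have := IHt1 (ltnW t1t); rewrite !modn_small; try lia.
  move=> w1; apply/walkS; exists (main s 0 t1).
    by move: w1; congr (walk _ _ _ _); lia.
  apply: arc_adj; rewrite /main ?[alive _]/= ?inordK //; try lia.
  rewrite /arc eqxx /tree_arc !depth_main; try lia.
  rewrite q0 /offset big_ord0 /jump /strand eqxx !inordK ?modn_small; lia.
have base t2 : t2 <= t -> t2 %% q l.+1 = 0 ->
    walk F (offset l.+1 + 2 * (t2 %% q l.+1) - t2).+1 src (main s l.+1 t2).
  move=> t2t m0; rewrite m0 muln0 addn0; apply: walk_tail => //.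
    by rewrite /dvdn m0.
  by apply: IHl; lia.
elim: t1 => [_|t1 IHt1 t1t]; first by apply: base; rewrite ?mod0n.
have [|/eqP] := orP (mod_succ (q l.+1) t1); last exact: base.
move=> /eqP m1; have := IHt1 (ltnW t1t).
have := @le_offset l.+1 t1; have := @le_offset l.+1 t1.+1.
move=> off1 off2 w1; apply/walkS; exists (main s l.+1 t1).
  by move: w1; rewrite m1; congr (walk _ _ _ _); lia.
apply: arc_adj; rewrite /main ?[alive _]/= ?inordK //; try lia.
rewrite /arc eqxx /tree_arc !depth_main; try lia.
rewrite m1 /jump /strand eqxx !inordK; lia.
Qed.

(** Level 0 is unbroken because [q 0 = L.+1], so it has an edge of this color. *)
Lemma fault_color : inl (s, t) \in colors tree_graph.
Proof.
have tL := ltn_ord t.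
apply/imsetP; exists (jump_edge s 0 t); last exact/esym/tree_col_jump.
apply/tree_edgesP; exists (main s 0 t), (main s 0 t.+1); split=> //.
rewrite /arc /main eqxx /tree_arc !depth_main; try lia.
rewrite q0 /offset big_ord0 /jump /strand eqxx !inordK ?modn_small; lia.
Qed.

Definition sources : {set vertex tree_graph} := source @: [set: 'I_sigma].

(** A shortest surviving walk to the target has length at most [D.+1], so its last vertex before the
    target has potential at most [D]; leaf [t] of tree [s] is the only such leaf. *)
Lemma leaf_edge_forced (H : {set {set vertex tree_graph}}) x :
  cft1_preserver sources H -> [set main s f t; target x] \in H.
Proof.
case=> sHE /(_ _ fault_color src (target x)).
move=> /(_ (imset_f _ (in_setT _))); set H' := del_color H _ => eq_dist.
have tL := ltn_ord t.
have /walk_dist[m le_m] : walk F D.+1 src (target x).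
  apply/walkS; exists (main s f t).
    have := @walk_main f t (leqnn _) (leqnn _).
    by rewrite qf modn1; congr (walk _ _ _ _); rewrite /D; lia.
  by apply: arc_adj; rewrite //= ?inordK //; lia.
rewrite -[F]/(del_color (edges tree_graph) _) -eq_dist => /distP[w_m _].
have sH'F : H' \subset F by apply: setSD.
case: m le_m w_m => [_ /walkP[p [/size0nil -> _]]|m le_m /walkS[z w_z zx]] //.
have pot_z : potential z <= D.
  apply: leq_trans (walk_lipschitz (phi := potential) _ w_z) _.
    move=> u v /(subsetP sH'F) uvF; move: (uvF); rewrite in_setD => /andP[_].
    case/tree_edgesP=> u' [v' [uv' e]]; rewrite e in uvF.
    have [] := arc_potential uv' uvF.
    by case/set2_eq: e => -[-> ->].
  by rewrite /src /= eqxx.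
have zxH : [set z; target x] \in H by move: zx; rewrite /adj in_setD => /andP[].
case/tree_edgesP: (subsetP sHE _ zxH) => u [v [uv /set2_eq[[zE xE]|[zE xE]]]]; last first.
  by move: uv; rewrite -xE; case: (v).
have leaf_z : arc z (target x) by rewrite zE xE.
case: z {w_z zx zE} pot_z zxH leaf_z => [[i|y]|[s' [[l t1]|//]]] //= pot_z zxH /andP[/eqP lf t1L].
move: pot_z; rewrite lf qf modn1; have := offset_ge f_gt0.
case: ifP => [/andP[/eqP ss t1t]|_]; last by lia.
move=> off le_D; have t1E : t1 = t :> nat by rewrite /D in le_D; lia.
move: zxH; rewrite ss; congr (_ \in H); congr [set inr (_, inl (_, _)); _];
by apply/val_inj; rewrite /= inordK //; lia.
Qed.

End Fault.

(** * Counting the forced edges *)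

Lemma forced_edges (H : {set {set vertex tree_graph}}) :
  cft1_preserver sources H -> sigma' * L * n <= #|H|.
Proof.
move=> pH.
pose g (a : 'I_sigma' * 'I_L * 'I_n) : {set vert} :=
  [set main a.1.1 f a.1.2; target a.2].
have g_inj : injective g.
  move=> [[s t] x] [[s' t'] x'] /set2_eq[[/main_inj[]]|[]] //=.
  - by rewrite ltnW.
  - by rewrite ltnW.
  - by move=> -> _ /val_inj -> [->].
rewrite -[sigma' * L * n](_ : #|{: 'I_sigma' * 'I_L * 'I_n}| = _); last first.
  by rewrite !card_prod !card_ord.
rewrite -(card_imset _ g_inj); apply/subset_leq_card/subsetP => e.
by case/imsetP=> -[[s t] x] _ ->; apply: leaf_edge_forced.
Qed.

Lemma tree_graph_exists : exists (G : ecgraph) (S : {set vertex G}),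
  [/\ #|vertex G| = sigma + n + sigma' * (f.+1 * L.+1 + f * N),
      forall k : color G, #|color_class k| <= f,
      #|S| = sigma &
      forall H : {set {set vertex G}}, cft1_preserver S H -> sigma' * L * n <= #|H|].
Proof.
exists tree_graph, sources; split.
- by rewrite card_sum card_prod !card_sum !card_prod !card_ord.
- exact: tree_color_class_le.
- by rewrite card_imset ?cardsT ?card_ord // => i j [].
- exact: forced_edges.
Qed.
End Construction.

(** * Choice of the radices and form of the bound *)

Local Open Scope ring_scope.

(* Rounding each power of rho, instead of rho itself, loses only a constant
   factor independent of D. *)
Lemma geometric_radix (R : realType) (rho : R) (D : nat) : 1 <= rho -> (0 < D)%N ->
  exists (L N : nat) (q : nat -> nat),
  [/\ q 0 = L.+1, q D = 1%N, forall l, (0 < q l)%N,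
      forall l, (l < D)%N -> ((L %/ q l.+1).+1 * (2 * q l) <= N)%N &
      [/\ rho ^+ D <= 2 * L%:R, L%:R <= rho ^+ D & N%:R <= 12 * rho ^+ D.+1]].
Proof.
move=> rho1 D_gt0; have X1 k : 1 <= rho ^+ k by apply: exprn_ege1.
have X0 k : 0 <= rho ^+ k by apply: le_trans (X1 k).
have trL k : (Num.truncn (rho ^+ k))%:R <= rho ^+ k by rewrite truncn_le.
have trG k : rho ^+ k <= 2 * (Num.truncn (rho ^+ k))%:R.
  have := truncnS_gt (rho ^+ k).
  have : (1 : R) <= (Num.truncn (rho ^+ k))%:R by rewrite ler1n truncn_gt0.
  by rewrite -natr1; lra.
(* The extra 1 at [l = 0] gives [q 0 = L.+1]. *)
pose q l := (Num.truncn (rho ^+ (D - l)) + (l == 0))%N.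
have q_gt0 l : (0 < q l)%N by rewrite addn_gt0 truncn_gt0 X1.
exists (Num.truncn (rho ^+ D)), (Num.truncn (12 * rho ^+ D.+1)), q.
split=> //; last by split=> //; rewrite truncn_le mulr_ge0.
- by rewrite /q subn0 addn1.
- by rewrite /q subnn expr0 truncn1; case: D D_gt0 {q q_gt0}.
move=> l lD; rewrite truncn_ge_nat; last by rewrite mulr_ge0.
have qU : (q l)%:R <= 2 * rho ^+ (D - l).
  rewrite /q natrD; have := trL (D - l)%N; have := X1 (D - l)%N.
  have : ((l == 0)%:R : R) <= 1 by case: (l == 0).
  by lra.
have qL : rho ^+ (D - l.+1) <= 2 * (q l.+1)%:R by rewrite /q addn0.
set L := Num.truncn (rho ^+ D); set a := (L %/ q l.+1)%N.
have a_le : a%:R <= 2 * rho ^+ l.+1.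
  have aL : a%:R * (q l.+1)%:R <= rho ^+ D.
    by apply: le_trans (trL D); rewrite -natrM ler_nat leq_divM.
  have pos : 0 < rho ^+ (D - l.+1) by apply: lt_le_trans (X1 _).
  rewrite -(ler_pM2r pos) -mulrA -exprD subnKC //.
  apply: le_trans (_ : a%:R * (2 * (q l.+1)%:R) <= _); first by apply: ler_wpM2l.
  by lra.
have -> : rho ^+ D.+1 = rho ^+ l.+1 * rho ^+ (D - l).
  by rewrite -exprD; congr (_ ^+ _); lia.
rewrite natrM -natr1 natrM.
apply: le_trans (_ : (3 * rho ^+ l.+1) * (4 * rho ^+ (D - l)) <= _); last by lra.
by apply: ler_pM; [rewrite natr1 | rewrite mulr_ge0 | have := X1 l.+1; lra | lra].
Qed.

(** Isolates the power of [x / y] that the number of leaves per tree has to match. *)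
Lemma target_powR (R : realType) (x y d : R) : 0 < x -> 0 < y -> 0 <= d ->
  x `^ (2 - 1 / (d + 1)) * y `^ (1 / (d + 1)) = x * y * (x / y) `^ (d / (d + 1)).
Proof.
move=> x0 y0 d0; set p := d / (d + 1).
have pE : 1 / (d + 1) = 1 - p by rewrite /p; field; lra.
have -> : 2 - 1 / (d + 1) = 1 + p by rewrite pE; ring.
have xpE : x `^ p = (x / y) `^ p * y `^ p.
  by rewrite -powRM ?divr_ge0 ?ltW // divfK // gt_eqF.
have [nzx nzy] : x != 0 /\ y != 0 by rewrite !gt_eqF.
have ypE : y `^ p * y `^ (1 - p) = y.
  by rewrite -powRD ?nzy ?implybT // addrC subrK powRr1 ?ltW.
rewrite pE (@powRD _ x 1 p) ?nzx ?implybT // powRr1 ?ltW // xpE.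
transitivity (x * (y `^ p * y `^ (1 - p)) * (x / y) `^ p); last by rewrite ypE.
by move: (_ `^ p) (y `^ p) (y `^ (1 - p)) => u v w; ring.
Qed.

(** * An edgeless graph for the degenerate cases *)

Section Edgeless.
Variable V : finType.

Lemma edgeless_card2 (e : {set V}) : e \in set0 -> #|e| = 2.
Proof. by rewrite in_set0. Qed.

Definition edgeless_graph := @ECGraph V set0 edgeless_card2 unit (fun=> tt).

Lemma edgeless_color_class (k : color edgeless_graph) : #|color_class k| = 0%N.
Proof. by apply: eq_card0 => e; rewrite !inE. Qed.

End Edgeless.

(** * Choice of parameters and the lower bound *)

Theorem theorem3p5 (R : realType) (K : nat) :
  exists a b c : R, [/\ 0 < a, 0 < b, 0 < c &
    forall n Delta sigma : nat, (sigma <= K * n)%N ->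
    exists (G : ecgraph) (S : {set vertex G}),
    [/\ a * n%:R <= #|vertex G|%:R <= b * n%:R,
        forall k : color G, (#|color_class k| <= Delta)%N,
        #|S| = sigma &
        forall H : {set {set vertex G}}, cft1_preserver S H ->
          c * (n%:R `^ (2 - 1 / (Delta%:R + 1))
               * sigma%:R `^ (1 / (Delta%:R + 1)) * (1 / Delta%:R))
          <= #|H|%:R]].
Proof.
(* At most [K * n] sources, [n] targets and [12 * n] tree vertices. The value of [c] serves
   [c * 32 <= 1] and [c * K <= 1]. *)
exists 1, (K + 13)%:R, (1 / (32 * (K%:R + 1))).
have K0 : 0 <= K%:R :> R by [].
have c_gt0 : 0 < 1 / (32 * (K%:R + 1)) :> R by rewrite divr_gt0 // mulr_gt0 //; lra.
split=> //; first by rewrite ltr0n addn_gt0 orbT.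
set c := 1 / _ in c_gt0 *.
have cK : c * (32 * (K%:R + 1)) = 1 by rewrite /c; field; lra.
have c32 : c * 32 <= 1.
  by rewrite -[leRHS]cK ler_pM2l // ler_peMr //; lra.
have cK1 : c * K%:R <= 1 by rewrite -[leRHS]cK ler_pM2l //; lra.
move=> n Delta sigma sKn.
(* The bound is 0 here: [1 / 0 = 0] by convention, and 0 to a nonzero power is 0. *)
have [/orP degenerate|] := boolP ((Delta == 0) || (sigma == 0))%N.
  exists (@edgeless_graph ('I_sigma + 'I_n)%type), [set inl i | i in 'I_sigma]; split.
  - by rewrite mul1r /= card_sum !card_ord -natrM !ler_nat; nia.
  - by move=> k; rewrite edgeless_color_class.
  - by rewrite card_imset ?card_ord // => i j [].
  - move=> H _; move: #|H| => h.
    case: degenerate => /eqP ->; first by rewrite invr0 !mulr0.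
    rewrite (@powR0 R (1 / _)) ?mulr0 ?mul0r ?mulr0 //.
    by rewrite mul1r invr_neq0 // natr1 pnatr_eq0.
rewrite negb_or -!lt0n => /andP[Delta_gt0 sigma_gt0].
have n_gt0 : (0 < n)%N by lia.
have n0 : 0 < n%:R :> R by rewrite ltr0n.
have s0 : 0 < sigma%:R :> R by rewrite ltr0n.
have D1 : 1 <= Delta%:R :> R by rewrite ler1n.
have p_le1 : Delta%:R / (Delta%:R + 1) <= 1 :> R by rewrite ler_pdivrMr; lra.
have p_ge0 : 0 <= Delta%:R / (Delta%:R + 1) :> R by rewrite divr_ge0 //; lra.
have bound (G : ecgraph) (H : {set {set vertex G}}) (sigma' L : nat) :
    (sigma' * L * n <= #|H|)%N ->
    c * (sigma%:R * (n%:R / sigma%:R) `^ (Delta%:R / (Delta%:R + 1)))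
      <= Delta%:R * (sigma' * L)%:R ->
    c * (n%:R `^ (2 - 1 / (Delta%:R + 1)) * sigma%:R `^ (1 / (Delta%:R + 1))
         * (1 / Delta%:R)) <= #|H|%:R.
  move=> leH le_c; apply: le_trans (_ : (sigma' * L * n)%:R <= _); last by rewrite ler_nat.
  rewrite target_powR //; move: (_ `^ _) le_c => z le_c.
  rewrite mul1r !mulrA ler_pdivrMr; last by lra.
  rewrite [X in _ <= X]mulrC natrM mulrA [X in X <= _](_ : _ = c * (sigma%:R * z) * n%:R).
    by rewrite ler_pM2r.
  by ring.
(* The 16 makes the trees fit into [n] vertices: 4 for the levels, 12 for the connections. *)
pose x : R := n%:R / (16 * Delta%:R * sigma%:R).
have y_def : n%:R / sigma%:R = x * (16 * Delta%:R).
  by rewrite /x; field; apply/andP; split; rewrite gt_eqF //; lra.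
have [x1|x1] := leP 1 x.
  pose rho := x `^ (1 / (Delta%:R + 1)).
  have rho1 : 1 <= rho.
    by rewrite -(powRr0 x) ler_powR // divr_ge0 //; lra.
  have rhoS : rho ^+ Delta.+1 = x.
    rewrite -powR_mulrn ?powR_ge0 // -powRrM -natr1 divfK ?powRr1 //; lra.
  have rhoD : rho ^+ Delta = x `^ (Delta%:R / (Delta%:R + 1)).
    by rewrite -powR_mulrn ?powR_ge0 // -powRrM; congr (_ `^ _); field; lra.
  have [L [N [q [q0 qD q_gt0 tailN [leL geL leN]]]]] := geometric_radix rho1 Delta_gt0.
  have vert_le : (sigma * (Delta.+1 * L.+1 + Delta * N) <= n)%N.
    have xE : x * (16 * Delta%:R * sigma%:R) = n%:R.
      by rewrite mulrA -y_def divfK // gt_eqF.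
    have u_le : rho ^+ Delta <= x by rewrite -rhoS ler_weXn2l.
    rewrite -(ler_nat R) -xE natrM mulrC mulrA ler_pM2r // natrD !natrM -!natr1.
    have DL : (Delta%:R + 1) * (L%:R + 1) <= (2 * Delta%:R) * (2 * x) :> R.
      by apply: ler_pM; rewrite ?natr1 //; lra.
    have DN : Delta%:R * N%:R <= Delta%:R * (12 * x) :> R.
      by apply: ler_wpM2l; [lra | rewrite -rhoS].
    by lra.
  have [G [S [cG cc cS lb]]] :=
    @tree_graph_exists n sigma sigma Delta L N q Delta_gt0 q0 qD q_gt0 tailN (leqnn _).
  exists G, S; split; [|exact: cc|exact: cS|].
    rewrite cG mul1r -natrM !ler_nat; move: vert_le sKn; clear; nia.
  move=> H /lb /bound; apply.
  have z_le : (n%:R / sigma%:R) `^ (Delta%:R / (Delta%:R + 1)) <= 2 * L%:R * (16 * Delta%:R) :> R.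
    rewrite y_def powRM; [|lra|lra].
    (* Bounding the power of [16 * Delta] by its base costs the factor [Delta] in the result. *)
    by apply: ler_pM; rewrite ?powR_ge0 -?rhoD // ler1_powR //; lra.
  apply: le_trans (_ : c * (sigma%:R * (2 * L%:R * (16 * Delta%:R))) <= _).
    by rewrite !ler_pM2l.
  have -> : c * (sigma%:R * (2 * L%:R * (16 * Delta%:R)))
    = (c * 32) * (Delta%:R * (sigma * L)%:R) by rewrite natrM; ring.
  by rewrite ler_piMl // mulr_ge0.
(* Now [n < 16 * Delta * sigma], and trees with one leaf and 12 vertices suffice. *)
pose sigma' := minn sigma n.
pose q (l : nat) := (l == 0).+1.
have q_gt0 l : (0 < q l)%N by [].
have tailN l : (l < 1)%N -> ((1 %/ q l.+1).+1 * (2 * q l) <= 8)%N by case: l.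
have [G [S [cG cc cS lb]]] := @tree_graph_exists n sigma sigma' 1 1 8 q
  isT erefl erefl q_gt0 tailN (geq_minl _ _).
exists G, S; split; [| |exact: cS|].
- rewrite cG mul1r -natrM !ler_nat; move: (geq_minr sigma n) sKn; rewrite -/sigma'; clear; nia.
- by move=> k; apply: leq_trans (cc k) _.
move=> H /lb /bound; apply.
(* If [sigma <= n], the power of [n / sigma] is at most [16 * Delta]; otherwise it is at most 1, and
   [sigma <= K * n] is used. *)
rewrite muln1; have [sn|ns] := leqP sigma n.
  rewrite /sigma' (minn_idPl sn).
  have y1 : 1 <= n%:R / sigma%:R :> R by rewrite ler_pdivlMr // mul1r ler_nat.
  have z_le := ler1_powR y1 p_le1.
  apply: le_trans (_ : c * (sigma%:R * (16 * Delta%:R)) <= _).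
    rewrite !ler_pM2l //; apply: le_trans z_le _.
    by rewrite y_def; apply: ler_piMl; lra.
  have -> : c * (sigma%:R * (16 * Delta%:R)) = (c * 16) * (Delta%:R * sigma%:R) by ring.
  by rewrite ler_piMl ?mulr_ge0 //; lra.
rewrite /sigma' (minn_idPr (ltnW ns)).
have y1 : n%:R / sigma%:R <= 1 :> R by rewrite ler_pdivrMr // mul1r ler_nat ltnW.
have z_le : (n%:R / sigma%:R) `^ (Delta%:R / (Delta%:R + 1)) <= 1 :> R.
  apply: le_trans (_ : 1 `^ (Delta%:R / (Delta%:R + 1)) <= _); last by rewrite powR1.
  by rewrite (ge0_ler_powR p_ge0) ?nnegrE ?divr_ge0.
apply: le_trans (_ : c * (K%:R * n%:R) <= _).
  rewrite ler_pM2l // -natrM; apply: le_trans (_ : sigma%:R <= _).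
    by rewrite ler_piMr.
  by rewrite ler_nat.
by rewrite mulrA ler_pM2r //; lra.
Qed.
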